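(* Let $G$ be a finite simple connected graph and $T$ a finite tree. If $G$ has a hamiltonian coloring that has a quartet, then the cartesian product $G\times T$ also has a hamiltonian coloring that has a quartet.
   Context: All graphs are finite and simple. A $2$-coloring $C$ of $V(G)$ is a hamiltonian coloring of $G$ if each of the two color classes induces a tree in $G$ (in particular each class is nonempty). For $X\subseteq V(G)$, $C\Delta X$ denotes the $2$-coloring obtained from $C$ by switching the colors of the vertices in $X$. If $C$ is a hamiltonian coloring of $G$ and $I,J$ are disjoint $2$-element subsets of $V(G)$, the ordered pair $(I,J)$ is a quartet of $C$ if: (Q1) each of $I$ and $J$ contains one vertex of each color of $C$; (Q2) $C\Delta I$ is a hamiltonian coloring of $G$; (Q3) for each color, the set of vertices having that color in $C\Delta J$ induces in $G$ a forest with exactly two connected components, one of which contains a vertex of $I$ and the other contains a vertex of $J$. The cartesian product $G\times H$ has vertex set $V(G)\times V(H)$, with $(u,x)$ adjacent to $(v,y)$ iff either $x=y$ and $uv\in E(G)$, or $u=v$ and $xy\in E(H)$. *)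

(* Defs.v *)
From mathcomp Require Import all_boot.
Set Implicit Arguments.
Unset Strict Implicit.
Unset Printing Implicit Defensive.

Record sgraph := SGraph {
  vertex :> finType;
  adj : rel vertex;
  adj_sym : symmetric adj;
  adj_irr : irreflexive adj }.

Definition connected (G : sgraph) : Prop :=
  0 < #|G| /\ forall x y : G, connect (@adj G) x y.

(* Duplicate-free cyclic sequences of size 2 traverse a single edge back and
   forth; the cycles of a simple graph are those of size at least 3. *)
Definition forest (G : sgraph) : Prop :=
  forall c : seq G, ucycle (@adj G) c -> size c < 3.

Definition tree (G : sgraph) : Prop := connected G /\ forest G.

Definition components (G : sgraph) : {set {set G}} :=
  equivalence_partition (connect (@adj G)) [set: G].

Section Induced.
Variables (G : sgraph) (X : {set G}).

Definition induced_adj : rel {x : G | x \in X} :=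
  fun x y => adj (val x) (val y).

Lemma induced_adj_sym : symmetric induced_adj.
Proof. by move=> x y; apply: adj_sym. Qed.

Lemma induced_adj_irr : irreflexive induced_adj.
Proof. by move=> x; apply: adj_irr. Qed.

Definition induced : sgraph := SGraph induced_adj_sym induced_adj_irr.
End Induced.

Section Cartesian.
Variables G H : sgraph.

Definition cart_adj : rel (G * H) := fun p q =>
  (p.2 == q.2) && adj p.1 q.1 || (p.1 == q.1) && adj p.2 q.2.

Lemma cart_adj_sym : symmetric cart_adj.
Proof.
move=> p q; rewrite /cart_adj [p.2 == _]eq_sym [p.1 == _]eq_sym.
by rewrite [adj p.1 _]adj_sym [adj p.2 _]adj_sym.
Qed.

Lemma cart_adj_irr : irreflexive cart_adj.
Proof. by move=> p; rewrite /cart_adj !adj_irr !andbF. Qed.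

Definition cartesian : sgraph := SGraph cart_adj_sym cart_adj_irr.
End Cartesian.

Definition coloring (G : sgraph) := {ffun G -> bool}.

Definition color_class (G : sgraph) (C : coloring G) (b : bool) : {set G} :=
  [set x | C x == b].

Definition switch (G : sgraph) (C : coloring G) (X : {set G}) : coloring G :=
  [ffun x => if x \in X then ~~ C x else C x].

Definition hamiltonian_coloring (G : sgraph) (C : coloring G) : Prop :=
  forall b, tree (induced (color_class C b)).

Definition splits (G : sgraph) (X I J : {set G}) : Prop :=
  forest (induced X) /\
  exists A B : {set induced X},
    [/\ A != B, components (induced X) = [set A; B],
        exists2 x, x \in A & val x \in I
      & exists2 y, y \in B & val y \in J].

Definition quartet (G : sgraph) (C : coloring G) (I J : {set G}) : Prop :=
  [/\ #|I| = 2, #|J| = 2 & [disjoint I & J]] /\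
  [/\ forall b, #|I :&: color_class C b| = 1 /\ #|J :&: color_class C b| = 1,
      hamiltonian_coloring (switch C I)
    & forall b, splits (color_class (switch C J) b) I J].

Definition has_coloring_with_quartet (G : sgraph) : Prop :=
  exists C : coloring G,
    hamiltonian_coloring C /\ exists I J : {set G}, quartet C I J.

(* Main.v *)
Require Import Defs.
From mathcomp Require Import all_boot.

(** Let [(I, J)] be a quartet of the hamiltonian coloring [C] of [G], and let [p]
be a proper 2-coloring of the tree [T]. Color the copy of [G] over [t] by [C] if
[p t] is false, and by the complement of [C Delta I] otherwise. Every copy of a
color class is a tree, and over each edge of [T] exactly one edge of [G x T],
at a vertex of [I], joins two vertices of the given color; so each color class
is a tree of trees. If [T] has at least two vertices, choose two leaves [r] and
[s] with [p r] false: [(J x {r}, I x {s})] is a quartet. Switching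
[J x {r}] splits each class over [r] in two, and each half is attached to the
neighbouring copy by one edge, at [I] for one half and at [J] for the other.
Switching [I x {s}] disconnects the copy over [s] from the rest.

Trees are handled through cuts: a set is connected if every cut of it is
crossed by an edge, and acyclic if every edge is the only one crossing some
cut. These conditions are stable under gluing and splitting along a bridge. *)

Set Implicit Arguments.
Unset Strict Implicit.
Unset Printing Implicit Defensive.

(** * Connectivity and acyclicity of vertex sets by cuts *)

Definition set_connected (G : sgraph) (X : {set G}) : Prop :=
  X != set0 /\ forall (S : {set G}) x y,
    x \in X -> y \in X -> x \in S -> y \notin S ->
    exists u v, [/\ u \in X, v \in X, u \in S, v \notin S & adj u v].

(** The cut form of acyclicity: every edge of the subgraph induced by [X] is a bridge of it. *)
Definition set_acyclic (G : sgraph) (X : {set G}) : Prop :=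
  forall x y, x \in X -> y \in X -> adj x y ->
  exists S : {set G}, [/\ x \in S, y \notin S &
    forall u v, u \in X -> v \in X -> u \in S -> v \notin S -> adj u v ->
      u = x /\ v = y].

Definition set_tree (G : sgraph) (X : {set G}) : Prop :=
  set_connected X /\ set_acyclic X.

Definition bridge (G : sgraph) (A B : {set G}) (a b : G) : Prop :=
  [/\ [disjoint A & B], a \in A, b \in B, adj a b &
      forall u v, u \in A -> v \in B -> adj u v -> u = a /\ v = b].

Definition separated (G : sgraph) (A B : {set G}) : Prop :=
  [disjoint A & B] /\ forall u v, u \in A -> v \in B -> ~~ adj u v.

(** * Agreement of the cut conditions with paths, cycles and induced subgraphs *)

Lemma connect_crossing (G : sgraph) (S : {set G}) (x y : G) :
  connect (@adj G) x y -> x \in S -> y \notin S ->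
  exists u v, [/\ u \in S, v \notin S & adj u v].
Proof.
case/connectP => p; elim: p x => [|z p IHp] x /=.
  by move=> _ -> ->.
case/andP => xz pz ey xS yS.
case: (boolP (z \in S)) => zS; first exact: IHp pz ey zS yS.
by exists x, z.
Qed.

Lemma connectedE (G : sgraph) : connected G <-> set_connected [set: G].
Proof.
split=> [[G0 cG]|[/set0Pn [x0 _] cG]]; split.
- by rewrite -cards_eq0 cardsT -lt0n.
- move=> S x y _ _ xS yS.
  have [u [v [uS vS uv]]] := connect_crossing (cG x y) xS yS.
  by exists u, v; rewrite !inE.
- by apply/card_gt0P; exists x0.
- move=> x y; apply/negPn/negP => nxy.
  have := cG [set z | connect (@adj G) x z] x y.
  rewrite !inE connect0 => /(_ isT isT isT nxy) [u [v []]].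
  rewrite !inE => _ _ xu /negP nxv uv; apply: nxv.
  exact: connect_trans xu (connect1 uv).
Qed.

(** In a forest, [y] cannot be reached from [x] once the edge [xy] is deleted, since a simple path
    would close up with it into a cycle; the vertices still reached from [x] form the cut.
    Conversely, a cycle that leaves a cut by one edge has to return by another. *)
Lemma forestE (G : sgraph) : forest G <-> set_acyclic [set: G].
Proof.
split=> [fG x y _ _ xy|aG c].
  pose e := [rel u v : G | adj u v &&
    ~~ ((u == x) && (v == y) || (u == y) && (v == x))].
  have nyS : ~~ connect e x y.
    apply/negP => /connectP [p0 p0e].
    case/shortenP: p0e => p pe upe _ ey.
    have pa : path (@adj G) x p.
      by apply: sub_path pe => u v /= /andP [].
    have: size (x :: p) < 3.
      by apply: fG; rewrite /ucycle upe andbT /= rcons_path pa -ey adj_sym xy.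
    case: p pe upe ey pa => [|z [|//]] /=.
    - by move=> _ _ eyx; rewrite eyx adj_irr in xy.
    - by rewrite andbT => /andP [_ /norP [n _]] _ eyz; rewrite -eyz !eqxx in n.
  exists [set z | connect e x z]; split; rewrite ?inE ?connect0 //.
  move=> u v _ _; rewrite !inE => xu nxv uv.
  case: (boolP (e u v)) => euv.
    by case/negP: nxv; apply: (connect_trans xu); apply: connect1.
  move: euv; rewrite /= uv /= negbK => /orP [] /andP [/eqP eu /eqP ev] //.
  by rewrite -eu xu in nyS.
case: c => [//|x [//|y [//|z p]]] /andP [].
rewrite /= => /and3P [xy yz zp] /andP [nx /andP [ny _]].
have [S [xS yS uS]] := aG x y (in_setT _) (in_setT _) xy.
have zS : z \notin S.
  apply/negP => zS; have [|ezx _] := uS z y (in_setT _) (in_setT _) zS yS.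
    by rewrite adj_sym.
  by rewrite ezx !inE eqxx orbT in nx.
(* Past [y] the walk stays outside [S]: a step back into [S] would have to start at [y], which does
   not recur. Yet the cycle closes at [x], in [S]. *)
have {nx yz} : y \notin z :: p by [].
elim: p z zp zS {ny} => [|w p IHp] z /=.
  rewrite andbT => zx zS; have [|_ ezy] := uS x z (in_setT _) (in_setT _) xS zS.
    by rewrite adj_sym.
  by rewrite ezy mem_head.
case/andP => zw wp zS; rewrite inE => /norP [nyz nyp].
apply: IHp wp _ nyp; apply/negP => wS.
have [|_ ezy] := uS w z (in_setT _) (in_setT _) wS zS.
  by rewrite adj_sym.
by rewrite ezy eqxx in nyz.
Qed.

Lemma induced_set_connected (G : sgraph) (X : {set G}) :
  set_connected [set: induced X] <-> set_connected X.
Proof.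
split=> [] [] /set0Pn [x0 x0P] cX; split.
- by apply/set0Pn; exists (val x0); apply: valP.
- move=> S x y xX yX xS yS.
  have := cX [set z | val z \in S] (Sub x xX) (Sub y yX).
  rewrite !inE !SubK => /(_ isT isT xS yS) [u [v [_ _]]].
  by rewrite !inE => uS vS uv; exists (val u), (val v); split=> //; apply: valP.
- by apply/set0Pn; exists (Sub x0 x0P); rewrite inE.
- move=> S x y _ _ xS yS.
  have [||||u [v [uX vX uS vS uv]]] := cX (val @: S) (val x) (val y).
  + exact: valP.
  + exact: valP.
  + by rewrite mem_imset //; apply: val_inj.
  + by rewrite mem_imset //; apply: val_inj.
  exists (Sub u uX), (Sub v vX); rewrite !inE; split=> //.
  + by rewrite -(mem_imset S _ val_inj) SubK.
  + by rewrite -(mem_imset S _ val_inj) SubK.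
Qed.

Lemma induced_set_acyclic (G : sgraph) (X : {set G}) :
  set_acyclic [set: induced X] <-> set_acyclic X.
Proof.
split=> aX x y xX yX xy.
- have [S [xS yS uS]] := aX (Sub x xX) (Sub y yX) (in_setT _) (in_setT _) xy.
  exists (val @: S); split.
  + by rewrite -[x](SubK {x | x \in X} xX) (mem_imset S _ val_inj).
  + by rewrite -[y](SubK {x | x \in X} yX) (mem_imset S _ val_inj).
  move=> u v uX vX.
  rewrite -[u](SubK {x | x \in X} uX) -[v](SubK {x | x \in X} vX).
  rewrite !(mem_imset S _ val_inj) => uS' vS' uv.
  by have [-> ->] := uS _ _ (in_setT _) (in_setT _) uS' vS' uv.
- have [S [xS yS uS]] := aX _ _ (valP x) (valP y) xy.
  exists [set z | val z \in S]; split; rewrite ?inE // => u v _ _.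
  rewrite !inE => uS' vS' uv.
  by have [/val_inj -> /val_inj ->] := uS _ _ (valP u) (valP v) uS' vS' uv.
Qed.

Lemma induced_treeE (G : sgraph) (X : {set G}) :
  tree (induced X) <-> set_tree X.
Proof.
split=> -[c f]; split.
- exact/induced_set_connected/connectedE.
- exact/induced_set_acyclic/forestE.
- exact/connectedE/induced_set_connected.
- exact/forestE/induced_set_acyclic.
Qed.

(** * Components, and the splitting required by (Q3) *)

Lemma sub_set_acyclic (G : sgraph) (A X : {set G}) :
  A \subset X -> set_acyclic X -> set_acyclic A.
Proof.
move=> /subsetP AX aX x y /AX xX /AX yX xy.
have [S [xS yS uS]] := aX x y xX yX xy.
by exists S; split=> // u v /AX uX /AX vX; apply: uS.
Qed.

Lemma component_set_tree (G : sgraph) (X : {set G}) (A : {set induced X}) :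
  set_acyclic X -> A \in components (induced X) -> set_tree (val @: A).
Proof.
move=> aX /imsetP [x _ eA].
split; last first.
  apply: sub_set_acyclic aX; apply/subsetP => _ /imsetP [z _ ->].
  exact: valP.
have inA z : (z \in A) = connect (@adj (induced X)) x z by rewrite eA !inE.
have xA : x \in A by rewrite inA connect0.
split; first by apply/set0Pn; exists (val x); apply: imset_f.
move=> S _ _ /imsetP [y yA ->] /imsetP [z zA ->] yS zS.
have symc : connect_sym (@adj (induced X)) by apply/sym_connect_sym/adj_sym.
have yz : connect (@adj (induced X)) y z.
  by move: yA zA; rewrite !inA => xy; rewrite (same_connect symc xy).
(* The cut is restricted to [A]: an edge starting in [A] also ends in [A], so an edge leaving
   [A :&: S] stays in the component and leaves [S]. *)
have [||u [v []]] := connect_crossing (S := A :&: [set w | val w \in S]) yz.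
- by rewrite !inE yA yS.
- by rewrite !inE negb_and zS orbT.
rewrite !inE => /andP [uA uS].
move=> vAS uv; have vA : v \in A.
  by move: uA; rewrite !inA => xu; apply: connect_trans xu (connect1 uv).
rewrite vA /= in vAS; exists (val u), (val v); split=> //; exact: imset_f.
Qed.

Lemma componentE (G : sgraph) (A : {set G}) (x : G) :
  A \in components G -> x \in A -> A = [set y | connect (@adj G) x y].
Proof.
have symc : connect_sym (@adj G) by apply/sym_connect_sym/adj_sym.
case/imsetP => z _ ->; rewrite !inE => zx; apply/setP => y; rewrite !inE.
exact: same_connect symc _ _ zx y.
Qed.

Lemma component_ex (G : sgraph) (x : G) :
  exists2 A, A \in components G & x \in A.
Proof.
exists [set y in [set: G] | connect (@adj G) x y]; last by rewrite !inE connect0.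
by apply: imset_f; rewrite inE.
Qed.

Lemma separated_sym (G : sgraph) (A B : {set G}) :
  separated A B -> separated B A.
Proof.
move=> [dAB nAB]; split; first by rewrite disjoint_sym.
by move=> u v uB vA; rewrite adj_sym nAB.
Qed.

(* The side of the cut in [C] that contains [a] absorbs all of [D]. *)
Lemma cut_extend (G : sgraph) (C D : {set G}) (a x y : G) :
  set_acyclic C -> [disjoint C & D] ->
  (forall u v, u \in C -> v \in D -> adj u v -> u = a) ->
  x \in C -> y \in C -> adj x y ->
  exists S : {set G}, [/\ x \in S, y \notin S & forall u v,
    u \in C :|: D -> v \in C :|: D -> u \in S -> v \notin S -> adj u v ->
    u = x /\ v = y].
Proof.
move=> aC dCD eCD xC yC xy; have [S [xS yS uS]] := aC x y xC yC xy.
case: (boolP (a \in S)) => aS.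
  exists ((S :&: C) :|: D); split.
  - by rewrite !inE xS xC.
  - by rewrite !inE (negbTE yS) (disjointFr dCD yC).
  move=> u v _; rewrite !inE => + + /norP [+ nvD] uv.
  rewrite (negbTE nvD) orbF => vC uS'; rewrite vC andbT => nvS.
  case/orP: uS' => [/andP [uS' uC]|uD]; first exact: uS.
  by rewrite (eCD v u vC uD) ?aS // adj_sym in nvS.
exists (S :&: C); split.
- by rewrite !inE xS xC.
- by rewrite !inE (negbTE yS).
move=> u v _; rewrite !inE => /orP [vC|vD] /andP [uS' uC].
  by rewrite vC andbT => nvS; apply: uS.
by move=> _ uv; rewrite -(eCD u v uC vD uv) uS' in aS.
Qed.

Lemma separated_acyclic (G : sgraph) (A B : {set G}) :
  separated A B -> set_acyclic A -> set_acyclic B -> set_acyclic (A :|: B).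
Proof.
move=> [dAB nAB] aA aB x y; rewrite !inE => /orP [xA|xB] /orP [yA|yB] xy.
(* No edge joins the two sets, so the condition on the attaching vertex is vacuous and any choice of
   it will do. *)
- apply: (cut_extend (a := x)) xy => // u v uA vB.
  by rewrite (negbTE (nAB _ _ uA vB)).
- by rewrite (negbTE (nAB _ _ xA yB)) in xy.
- by rewrite adj_sym (negbTE (nAB _ _ yA xB)) in xy.
- rewrite setUC; apply: (cut_extend (a := x)) xy => //.
    by rewrite disjoint_sym.
  by move=> u v uB vA; rewrite adj_sym (negbTE (nAB _ _ vA uB)).
Qed.

(** This trades components of the induced graph for explicit subsets of [G]. A connected part of [X]
    without edges to the rest of [X] is the component of each of its points, and acyclicity passes
    between [X] and the two parts. *)
Lemma splitsE (G : sgraph) (X I J : {set G}) :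
  splits X I J <-> exists A B : {set G},
    [/\ X = A :|: B, separated A B, set_tree A & set_tree B] /\
    [/\ exists2 x, x \in A & x \in I & exists2 y, y \in B & y \in J].
Proof.
split.
  case=> /forestE/induced_set_acyclic aX [A [B [nAB eC [x xA xI] [y yB yJ]]]].
  have AC : A \in components (induced X) by rewrite eC !inE eqxx.
  have BC : B \in components (induced X) by rewrite eC !inE eqxx orbT.
  have nc u v : u \in A -> v \in B -> ~~ connect (@adj (induced X)) u v.
    move=> uA vB; apply/negP => uv; case/eqP: nAB.
    rewrite (componentE AC uA) (componentE BC vB); apply/setP => z.
    by rewrite !inE; apply: (same_connect _ uv); apply/sym_connect_sym/adj_sym.
  exists (val @: A), (val @: B); split; split.
  - apply/setP => z; rewrite !inE; apply/idP/orP => [zX|]; last first.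
      by case=> /imsetP [u _ ->]; apply: valP.
    have [C] := component_ex (Sub z zX : induced X).
    rewrite eC !inE => /orP [] /eqP -> zC; [left|right];
      by apply/imsetP; exists (Sub z zX).
  - split.
      rewrite disjoint_subset; apply/subsetP => _ /imsetP [u uA ->].
      rewrite inE; apply/negP => /imsetP [v vB /val_inj euv].
      by move: (nc u v uA vB); rewrite euv connect0.
    move=> _ _ /imsetP [u uA ->] /imsetP [v vB ->].
    by apply: contra (nc u v uA vB) => uv; apply: connect1.
  - exact: component_set_tree.
  - exact: component_set_tree.
  - by exists (val x) => //; apply: imset_f.
  - by exists (val y) => //; apply: imset_f.
case=> A [B [[eX [dAB nAB] tA tB] [[x xA xI] [y yB yJ]]]].
have comp (C D : {set G}) (z : induced X) : X = C :|: D -> set_connected C ->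
    (forall u v, u \in C -> v \in D -> ~~ adj u v) -> val z \in C ->
    [set w in [set: induced X] | connect (@adj (induced X)) z w] =
    [set w | val w \in C].
  move=> eXCD [_ cC] nCD zC; apply/setP => w; rewrite !inE /=; apply/idP/idP.
    move=> zw; apply/negPn/negP => nwC.
    have [||u [v []]] :=
      connect_crossing (S := [set u : induced X | val u \in C]) zw.
    - by rewrite inE.
    - by rewrite inE.
    rewrite !inE => uC nvC uv.
    have: val v \in C :|: D by rewrite -eXCD; apply: valP.
    rewrite inE (negbTE nvC) /= => vD.
    by case/negP: (nCD _ _ uC vD).
  move=> wC; apply/negPn/negP => nzw.
  have [||u [v [uC vC]]] :=
    cC (val @: [set u : induced X | connect (@adj (induced X)) z u])
      (val z) (val w) zC wC.
  - by rewrite (mem_imset _ _ val_inj) inE.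
  - by rewrite (mem_imset _ _ val_inj) inE.
  case/imsetP => u'; rewrite inE => zu' -> nv uv.
  have vX : v \in X by rewrite eXCD inE vC.
  case/negP: nv; rewrite -[v](SubK {x | x \in X} vX).
  rewrite (mem_imset _ _ val_inj) inE.
  by apply: connect_trans zu' (connect1 _).
have xX : x \in X by rewrite eX inE xA.
have yX : y \in X by rewrite eX inE yB orbT.
have nBA u v : u \in B -> v \in A -> ~~ adj u v.
  by move=> uB vA; rewrite adj_sym nAB.
have compA z := comp A B z eX tA.1 nAB.
have compB z := comp B A z (etrans eX (setUC A B)) tB.1 nBA.
split.
  apply/forestE/induced_set_acyclic; rewrite eX.
  by apply: separated_acyclic; [split|apply: tA.2|apply: tB.2].
exists [set w | val w \in A], [set w | val w \in B]; split.
- apply/eqP => /setP /(_ (Sub x xX)); rewrite !inE /= xA.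
  by rewrite (disjointFr dAB xA).
- apply/setP => C; rewrite !inE; apply/imsetP/orP.
    case=> z _ ->; have: val z \in A :|: B by rewrite -eX; apply: valP.
    rewrite inE => /orP [zA|zB].
      by left; rewrite compA.
    by right; rewrite compB.
  case=> /eqP ->.
    by exists (Sub x xX); rewrite ?inE // compA.
  by exists (Sub y yX); rewrite ?inE // compB.
- by exists (Sub x xX); rewrite ?inE.
- by exists (Sub y yX); rewrite ?inE.
Qed.

(** * Gluing and splitting trees along a bridge *)

Lemma bridge_sym (G : sgraph) (A B : {set G}) (a b : G) :
  bridge A B a b -> bridge B A b a.
Proof.
case=> dAB aA bB ab uAB; split; rewrite 1?disjoint_sym 1?adj_sym //.
by move=> u v uB vA; rewrite adj_sym => /(uAB _ _ vA uB) [].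
Qed.

(** A cut of the union separates two points of [A], or two points of [B], or leaves both sets whole
    and is crossed by the bridge. For acyclicity, the bridge is isolated by the cut between [A] and
    [B]; any other edge keeps its cut within its own set, the other set joining the side of the end
    of the bridge. *)
Lemma bridge_set_tree (G : sgraph) (A B : {set G}) (a b : G) :
  bridge A B a b -> set_tree A -> set_tree B -> set_tree (A :|: B).
Proof.
move=> brAB [[A0 cA] aA] [[B0 cB] aB].
have brBA := bridge_sym brAB.
have [dAB aAB bB ab uAB] := brAB; have [dBA _ _ ba uBA] := brBA.
split; first split.
- by apply/set0Pn; exists a; rewrite inE aAB.
- move=> S x y xX yX xS yS.
  have [|nA] := boolP [exists u in A, exists v in A, (u \in S) && (v \notin S)].
    case/existsP => x' /andP [x'A] /existsP [y' /and3P [y'A x'S y'S]].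
    have [u [v [uA vA uS vS uv]]] := cA S x' y' x'A y'A x'S y'S.
    by exists u, v; rewrite !inE uA vA.
  have [|nB] := boolP [exists u in B, exists v in B, (u \in S) && (v \notin S)].
    case/existsP => x' /andP [x'A] /existsP [y' /and3P [y'A x'S y'S]].
    have [u [v [uB vB uS vS uv]]] := cB S x' y' x'A y'A x'S y'S.
    by exists u, v; rewrite !inE uB vB !orbT.
  have constA u v : u \in A -> v \in A -> u \in S -> v \in S.
    move=> uA vA uS; apply/negPn/negP => vS; case/negP: nA.
    by apply/existsP; exists u; rewrite uA; apply/existsP; exists v; rewrite vA uS.
  have constB u v : u \in B -> v \in B -> u \in S -> v \in S.
    move=> uA vA uS; apply/negPn/negP => vS; case/negP: nB.
    by apply/existsP; exists u; rewrite uA; apply/existsP; exists v; rewrite vA uS.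
  move: xX yX; rewrite !inE => /orP [xA|xB] /orP [yA|yB].
  + by rewrite (constA x y) in yS.
  + exists a, b; rewrite !inE aAB bB orbT; split=> //; first exact: constA xS.
    by apply: contra yS; apply: constB.
  + exists b, a; rewrite !inE aAB bB orbT; split=> //; first exact: constB xS.
    by apply: contra yS; apply: constA.
  + by rewrite (constB x y) in yS.
- have cross u v : u \in A -> v \in B -> adj u v ->
      exists S : {set G}, [/\ u \in S, v \notin S & forall x y,
      x \in A :|: B -> y \in A :|: B -> x \in S -> y \notin S -> adj x y ->
      x = u /\ y = v].
    move=> uA vB uv; exists A; split=> //; first by rewrite (disjointFl dAB vB).
    move=> x y _; rewrite inE => /orP [-> //|yB] xA _ xy.
    by have [-> ->] := uAB _ _ xA yB xy; have [-> ->] := uAB _ _ uA vB uv.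
  have cross' u v : u \in B -> v \in A -> adj u v ->
      exists S : {set G}, [/\ u \in S, v \notin S & forall x y,
      x \in A :|: B -> y \in A :|: B -> x \in S -> y \notin S -> adj x y ->
      x = u /\ y = v].
    move=> uA vB uv; exists B; split=> //; first by rewrite (disjointFr dAB vB).
    move=> x y _; rewrite inE orbC => /orP [-> //|yB] xA _ xy.
    by have [-> ->] := uBA _ _ xA yB xy; have [-> ->] := uBA _ _ uA vB uv.
  move=> x y; rewrite ![_ \in A :|: B]inE => /orP [xA|xB] /orP [yA|yB] xy.
  + by apply: (cut_extend (a := a)) xy => // u v uA vB /(uAB _ _ uA vB) [].
  + exact: cross.
  + exact: cross'.
  + rewrite setUC; apply: (cut_extend (a := b)) xy => // u v uA vB.
    by case/(uBA _ _ uA vB).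
Qed.

(** A cut of [A] is extended by putting [B] on the side of [a]. The bridge does not cross it, so the
    crossing edge found in the union lies in [A]. *)
Lemma bridge_set_treel (G : sgraph) (A B : {set G}) (a b : G) :
  bridge A B a b -> set_tree (A :|: B) -> set_tree A.
Proof.
move=> [dAB aA bB ab uAB] [[_ cX] aX]; split; last first.
  by apply: sub_set_acyclic aX; apply: subsetUl.
split; first by apply/set0Pn; exists a.
move=> S x y xA yA xS yS.
case: (boolP (a \in S)) => aS.
  have [||||u [v [+ +]]] := cX (~: (A :\: S)) x y.
  - by rewrite inE xA.
  - by rewrite inE yA.
  - by rewrite !inE xS.
  - by rewrite !inE yA yS.
  rewrite !inE !negbK => uX _ + /andP [vS vA] uv.
  move: uX => /orP [uA|uB]; first by rewrite uA andbT negbK => uS; exists u, v.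
  have [|eva _] := uAB v u vA uB; first by rewrite adj_sym.
  by rewrite eva aS in vS.
have [||||u [v [+ +]]] := cX (S :&: A) x y.
- by rewrite inE xA.
- by rewrite inE yA.
- by rewrite !inE xS.
- by rewrite !inE yA (negbTE yS).
rewrite !inE => _ vX /andP [uS uA] + uv.
move: vX => /orP [vA|vB]; first by rewrite vA andbT => vS; exists u, v.
have [eua _] := uAB u v uA vB uv.
by rewrite eua (negbTE aS) in uS.
Qed.

Lemma bridge_set_treer (G : sgraph) (A B : {set G}) (a b : G) :
  bridge A B a b -> set_tree (A :|: B) -> set_tree B.
Proof. by move/bridge_sym; rewrite setUC; apply: bridge_set_treel. Qed.

(** * Tree induction, leaves and bipartition *)

Lemma set_tree_ind (G : sgraph) (P : {set G} -> Prop) :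
  (forall t, P [set t]) ->
  (forall A B a b, bridge A B a b -> set_tree A -> set_tree B ->
    P A -> P B -> P (A :|: B)) ->
  forall U, set_tree U -> P U.
Proof.
move=> P1 PU U; have [n] := ubnP #|U|.
elim: n U => // n IHn U; rewrite ltnS => leU tU.
have [/set0Pn [t tU'] cU] := tU.1.
have [eU|] := eqVneq U [set t]; first by rewrite eU.
rewrite eqEsubset sub1set tU' andbT => /subsetPn [u uU]; rewrite inE => nut.
(* A tree with a second vertex has an edge; the cut that acyclicity gives for it makes it a bridge
   between two smaller trees. *)
have [||||x [y [xU yU _ _ xy]]] := cU [set t] t u; rewrite ?inE //.
have [S [xS yS uS]] := tU.2 x y xU yU xy.
have br : bridge (U :&: S) (U :\: S) x y.
  split; rewrite ?inE ?xU ?yU ?xS ?yS //.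
    rewrite disjoint_subset; apply/subsetP => z; rewrite !inE => /andP [_ ->] //.
  by move=> v w /setIP [vU vS] /setDP [wU wS]; apply: uS.
have eU := setID U S.
have tA : set_tree (U :&: S) by apply: bridge_set_treel br _; rewrite eU.
have tB : set_tree (U :\: S) by apply: bridge_set_treer br _; rewrite eU.
have cU' := cardsID S U.
have A0 : 0 < #|U :&: S| by rewrite card_gt0; exact: tA.1.1.
have B0 : 0 < #|U :\: S| by rewrite card_gt0; exact: tB.1.1.
rewrite -eU; apply: PU br tA tB (IHn _ _ tA) (IHn _ _ tB).
  by apply: leq_trans leU; rewrite -cU' -addn1 leq_add2l.
by apply: leq_trans leU; rewrite -cU' -add1n leq_add2r.
Qed.

(** [r] is a leaf of the graph induced by [U], hanging from [w]. *)
Definition pendant (G : sgraph) (U : {set G}) (r w : G) : Prop :=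
  [/\ r \in U, w \in U, adj r w & forall z, z \in U -> adj r z -> z = w].

(** A one-vertex [B] is itself a leaf hanging from [a]. Otherwise a leaf of [B] other than [b]
    remains a leaf, as the bridge touches [B] only at [b]. *)
Lemma bridge_pendant (G : sgraph) (A B : {set G}) (a b v : G) :
  bridge A B a b -> v \in A ->
  (B <> [set b] -> exists r w, r <> b /\ pendant B r w) ->
  exists r w, r <> v /\ pendant (A :|: B) r w.
Proof.
move=> [dAB aA bB ab uAB] vA IHB.
have neq z : z \in B -> z <> v.
  by move=> zB ezv; rewrite -ezv (disjointFl dAB zB) in vA.
have [eB|/eqP nB] := eqVneq B [set b].
  exists b, a; split; first exact: neq.
  split; rewrite ?inE ?aA ?bB ?orbT 1?adj_sym // => z.
  rewrite eB !inE => /orP [zA|/eqP ->]; last by rewrite adj_irr.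
  by rewrite adj_sym => /(uAB _ _ zA bB) [].
have [r [w [nrb [rB wB rw urw]]]] := IHB nB.
exists r, w; split; first exact: neq.
split; rewrite ?inE ?rB ?wB ?orbT // => z.
rewrite inE => /orP [zA|zB]; last exact: urw.
by rewrite adj_sym => /(uAB _ _ zA rB) [_ /nrb].
Qed.

(** Avoiding a given vertex is what the induction needs: in the half without [v], the leaf has to
    differ from the end of the bridge. Applied twice, it also yields two distinct leaves. *)
Lemma set_tree_pendant (G : sgraph) (U : {set G}) (v : G) :
  set_tree U -> v \in U -> U <> [set v] -> exists r w, r <> v /\ pendant U r w.
Proof.
move=> tU; elim/set_tree_ind: U / tU v => [t v|A B a b br tA tB IHA IHB v].
  by rewrite inE => /eqP ->.
have [_ aA bB _ _] := br.
rewrite inE => /orP [vA|vB] _.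
  by apply: bridge_pendant br vA _; apply: IHB.
by rewrite setUC; apply: bridge_pendant (bridge_sym br) vB _; apply: IHA.
Qed.

Lemma pendant_bridge (G : sgraph) (U : {set G}) (r w : G) :
  pendant U r w -> bridge [set r] (U :\ r) r w.
Proof.
case=> rU wU rw urw; split; rewrite ?inE ?eqxx //.
- by rewrite disjoints1 !inE eqxx.
- by rewrite wU andbT; apply: contraTneq rw => ->; rewrite adj_irr.
by move=> u v /set1P -> /setD1P [_ vU] /(urw _ vU).
Qed.

Lemma set_tree_del_pendant (G : sgraph) (U : {set G}) (r w : G) :
  set_tree U -> pendant U r w -> set_tree (U :\ r).
Proof.
move=> tU prw; have [rU _ _ _] := prw.
by apply: bridge_set_treer (pendant_bridge prw) _; rewrite setD1K.
Qed.

Lemma set_tree_bipartite (G : sgraph) (U : {set G}) :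
  set_tree U -> exists p : G -> bool,
    forall u v, u \in U -> v \in U -> adj u v -> p u != p v.
Proof.
move=> tU; elim/set_tree_ind: U / tU => [t|A B a b br _ _ [p pA] [q qB]].
  by exists xpredT => u v /set1P -> /set1P ->; rewrite adj_irr.
have [dAB aA bB ab uAB] := br.
(* The coloring of [B] is flipped exactly when [p a = q b], so that the ends of the bridge get
   different colors. *)
exists (fun z => if z \in A then p z else q z (+) (p a (+) ~~ q b)).
have cross u v : u \in A -> v \in B -> adj u v ->
    p u != q v (+) (p a (+) ~~ q b).
  move=> uA vB /(uAB _ _ uA vB) [-> ->].
  by case: (p a) (q b) => [] [].
have nA z : z \in B -> z \in A = false by move=> zB; rewrite (disjointFl dAB zB).
move=> u v; rewrite !inE => /orP [uA|uB] /orP [vA|vB] uv.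
- by rewrite uA vA; apply: pA.
- by rewrite uA (nA v vB); apply: cross.
- by rewrite vA (nA u uB) eq_sym; apply: cross => //; rewrite adj_sym.
- by rewrite (nA u uB) (nA v vB) (inj_eq (@addIb _)); apply: qB.
Qed.

Lemma bridge_separated (G : sgraph) (A B C : {set G}) (a b : G) :
  bridge A B a b -> separated A C -> bridge A (B :|: C) a b.
Proof.
move=> [dAB aA bB ab uAB] [dAC nAC]; split; rewrite ?inE ?bB //.
  by rewrite -setI_eq0 setIUr setU_eq0 !setI_eq0 dAB.
move=> u v uA; rewrite inE => /orP [vB|vC]; first exact: uAB.
by rewrite (negbTE (nAC _ _ uA vC)).
Qed.

(** * Subsets of the product given by one fiber over each vertex of the base *)

Definition bundle (G T : sgraph) (U : {set T}) (X : T -> {set G}) :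
    {set cartesian G T} :=
  [set q : cartesian G T | (q.2 \in U) && (q.1 \in X q.2)].

Lemma in_bundle (G T : sgraph) (U : {set T}) (X : T -> {set G}) (x : G) (t : T) :
  ((x, t) \in bundle U X) = (t \in U) && (x \in X t).
Proof. by rewrite inE. Qed.

Lemma bundleU (G T : sgraph) (A B : {set T}) (X : T -> {set G}) :
  bundle (A :|: B) X = bundle A X :|: bundle B X.
Proof. by apply/setP => q; rewrite !inE andb_orl. Qed.

Lemma bundle1U (G T : sgraph) (U : {set T}) (A B : {set G}) :
  bundle U (fun=> A :|: B) = bundle U (fun=> A) :|: bundle U (fun=> B).
Proof. by apply/setP => q; rewrite !inE andb_orr. Qed.

Lemma eq_bundle (G T : sgraph) (U : {set T}) (X Y : T -> {set G}) :
  (forall t, t \in U -> X t = Y t) -> bundle U X = bundle U Y.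
Proof.
move=> eXY; apply/setP => q; rewrite !inE; case: (boolP (q.2 \in U)) => // qU.
by rewrite (eXY _ qU).
Qed.

Lemma card_bundle1 (G T : sgraph) (t : T) (X : T -> {set G}) :
  #|bundle [set t] X| = #|X t|.
Proof.
have inj : injective (fun x : G => (x, t) : cartesian G T) by move=> x y [].
rewrite -(card_imset _ inj); apply: eq_card => -[x u]; rewrite in_bundle inE.
apply/andP/imsetP => [[/eqP -> xX]|[y yX [-> ->]]]; last by rewrite eqxx.
by exists x.
Qed.

Lemma cart_adj_fiber (G T : sgraph) (t : T) (x y : G) :
  @adj (cartesian G T) (x, t) (y, t) = adj x y.
Proof. by rewrite /= /cart_adj /= eqxx adj_irr andbF orbF. Qed.

Lemma cart_adj_cross (G T : sgraph) (t u : T) (x y : G) :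
  t != u -> @adj (cartesian G T) (x, t) (y, u) = (x == y) && adj t u.
Proof. by move=> ntu; rewrite /= /cart_adj /= (negbTE ntu). Qed.

(** A product edge between different copies keeps its [G]-coordinate and projects to an edge of [T],
    here [ab]. So the edges across correspond to the common points of [X a] and [Y b]. *)
Lemma bridge_bundle (G T : sgraph) (A B : {set T}) (X Y : T -> {set G})
    (a b : T) (x : G) :
  bridge A B a b -> x \in X a -> x \in Y b ->
  (forall y, y \in X a -> y \in Y b -> y = x) ->
  bridge (bundle A X) (bundle B Y) (x, a) (x, b).
Proof.
move=> [dAB aA bB ab uAB] xX xY ux.
have neq t u : t \in A -> u \in B -> t != u.
  by move=> tA uB; apply: contraTneq uB => <-; rewrite (disjointFr dAB tA).
split; rewrite ?in_bundle ?aA ?bB ?cart_adj_cross ?eqxx ?neq //.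
  rewrite disjoint_subset; apply/subsetP => -[y t].
  rewrite in_bundle => /andP [tA _].
  by rewrite inE in_bundle (disjointFr dAB tA).
move=> [y t] [z u]; rewrite !in_bundle => /andP [tA yX] /andP [uB zY].
rewrite cart_adj_cross ?neq // => /andP [/eqP eyz tu].
have [et eu] := uAB _ _ tA uB tu; rewrite -eyz {}et {}eu in yX zY *.
by rewrite (ux y).
Qed.

Lemma separated_bundle (G T : sgraph) (A B : {set T}) (X Y : T -> {set G}) :
  (forall t, t \in A -> t \in B -> separated (X t) (Y t)) ->
  (forall t u, t \in A -> u \in B -> adj t u -> [disjoint X t & Y u]) ->
  separated (bundle A X) (bundle B Y).
Proof.
move=> sXY dXY; split.
  rewrite disjoint_subset; apply/subsetP => -[x t].
  rewrite in_bundle => /andP [tA xX]; rewrite inE in_bundle.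
  apply/negP => /andP [tB xY].
  by have [dXYt _] := sXY t tA tB; rewrite (disjointFr dXYt xX) in xY.
move=> [x t] [y u]; rewrite !in_bundle => /andP [tA xX] /andP [uB yY].
have [etu|ntu] := eqVneq t u.
  rewrite -{}etu in uB yY *; rewrite cart_adj_fiber.
  by have [_] := sXY t tA uB; apply.
rewrite cart_adj_cross //; apply/negP => /andP [/eqP exy tu].
by rewrite -exy (disjointFr (dXY t u tA uB tu) xX) in yY.
Qed.

Lemma set_tree_bundle1 (G T : sgraph) (t : T) (X : T -> {set G}) :
  set_tree (X t) -> set_tree (bundle [set t] X).
Proof.
case=> [[/set0Pn [x0 x0X] cX] aX]; split; first split.
- by apply/set0Pn; exists (x0, t); rewrite in_bundle inE eqxx.
- move=> S [x t1] [y t2]; rewrite !in_bundle !inE.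
  move=> /andP [/eqP -> xX] /andP [/eqP -> yX] xS yS.
  have [||u [v []]] := cX [set z | (z, t) \in S] x y xX yX.
  + by rewrite inE.
  + by rewrite inE.
  rewrite !inE => uX vX uS vS uv.
  by exists (u, t), (v, t); rewrite !in_bundle cart_adj_fiber !inE eqxx.
- move=> [x t1] [y t2]; rewrite !in_bundle !inE.
  move=> /andP [/eqP -> xX] /andP [/eqP -> yX]; rewrite cart_adj_fiber => xy.
  have [S [xS yS uS]] := aX x y xX yX xy.
  exists [set q | q.1 \in S]; split; rewrite ?inE // => -[u t3] [v t4].
  rewrite !in_bundle !inE.
  move=> /andP [/eqP -> uX] /andP [/eqP -> vX] uS' vS'; rewrite cart_adj_fiber.
  by case/(uS u v uX vX uS' vS') => -> ->.
Qed.

(** By induction on the base: its bridge lifts to a bridge at the single common point of the fibers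
    over its ends. *)
Lemma set_tree_bundle (G T : sgraph) (U : {set T}) (X : T -> {set G}) :
  set_tree U -> (forall t, t \in U -> set_tree (X t)) ->
  (forall t u, t \in U -> u \in U -> adj t u -> #|X t :&: X u| = 1) ->
  set_tree (bundle U X).
Proof.
move=> tU; elim/set_tree_ind: U / tU => [t tX _|A B a b br _ _ IHA IHB tX eX].
  by apply: set_tree_bundle1; apply: tX; rewrite inE.
have [_ aA bB ab _] := br.
have /eqP/cards1P [x ex] : #|X a :&: X b| = 1.
  by apply: eX; rewrite ?inE ?aA ?bB ?orbT.
have /setIP [xa xb] : x \in X a :&: X b by rewrite ex set11.
have ux y : y \in X a -> y \in X b -> y = x.
  by move=> ya yb; apply/set1P; rewrite -ex inE ya.
rewrite bundleU; apply: bridge_set_tree (bridge_bundle br xa xb ux) _ _.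
- apply: IHA => [t tA|t u tA uA]; first by apply: tX; rewrite inE tA.
  by apply: eX; rewrite inE ?tA ?uA.
- apply: IHB => [t tB|t u tB uB]; first by apply: tX; rewrite inE tB orbT.
  by apply: eX; rewrite inE ?tB ?uB orbT.
Qed.

(** * Colorings of the product, one coloring of [G] per copy *)

Definition neg_coloring (G : sgraph) (C : coloring G) : coloring G :=
  [ffun x => ~~ C x].

Definition bundle_coloring (G T : sgraph) (F : T -> coloring G) :
    coloring (cartesian G T) :=
  [ffun q : cartesian G T => F q.2 q.1].

Lemma color_class_neg (G : sgraph) (C : coloring G) b :
  color_class (neg_coloring C) b = color_class C (~~ b).
Proof. by apply/setP => x; rewrite !inE ffunE eqb_negLR. Qed.

Lemma color_class_bundle (G T : sgraph) (F : T -> coloring G) b :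
  color_class (bundle_coloring F) b =
  bundle [set: T] (fun t => color_class (F t) b).
Proof. by apply/setP => q; rewrite !inE ffunE. Qed.

Lemma switch_bundle (G T : sgraph) (F : T -> coloring G) (r : T) (X : {set G}) :
  switch (bundle_coloring F) (bundle [set r] (fun=> X)) =
  bundle_coloring (fun t => if t == r then switch (F t) X else F t).
Proof.
by apply/ffunP => -[x t]; rewrite !ffunE !inE /=; case: eqP; rewrite ?ffunE.
Qed.

Lemma card_bundle1_color (G T : sgraph) (F : T -> coloring G) (t : T)
    (X : {set G}) b :
  #|bundle [set t] (fun=> X) :&: color_class (bundle_coloring F) b| =
  #|X :&: color_class (F t) b|.
Proof.
rewrite -(card_bundle1 t (fun t => X :&: color_class (F t) b)); apply: eq_card.
by move=> q; rewrite color_class_bundle !inE /= andbA.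
Qed.

(** * Construction of the quartet in the product *)

Theorem theorem2 (G T : sgraph) (hG : connected G) (hT : tree T) :
  has_coloring_with_quartet G -> has_coloring_with_quartet (cartesian G T).
Proof.
case=> C [hC [I [J [[cI cJ dIJ] [tr hI sJ]]]]].
have tT : set_tree [set: T].
  by case: hT => ? ?; split; [apply/connectedE|apply/forestE].
have tC b : set_tree (color_class C b) by apply/induced_treeE.
have tI b : set_tree (color_class (switch C I) b) by apply/induced_treeE.
have [/card_gt0P [r0 _] _] := hT.1.
(* A one-vertex [T] lacks two leaves, but then the product is a copy of [G] and the quartet is
   carried over in its order. *)
have [eT|/eqP nT] := eqVneq [set: T] [set r0].
  have noadj t u : ~~ @adj T t u.
    have: t \in [set: T] by [].
    have: u \in [set: T] by [].
    by rewrite eT => /set1P -> /set1P ->; rewrite adj_irr.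
  have tree_const (X : {set G}) :
      set_tree X -> set_tree (bundle [set: T] (fun=> X)).
    move=> tX; apply: set_tree_bundle => // t u _ _.
    by rewrite (negbTE (noadj t u)).
  have switch_const (X : {set G}) :
      switch (bundle_coloring (fun=> C)) (bundle [set: T] (fun=> X)) =
      bundle_coloring (fun=> switch C X).
    by apply/ffunP => -[x t]; rewrite !ffunE !inE.
  exists (bundle_coloring (fun=> C)); split.
    by move=> b; apply/induced_treeE; rewrite color_class_bundle; apply: tree_const.
  exists (bundle [set: T] (fun=> I)), (bundle [set: T] (fun=> J)); split; split.
  - by rewrite eT card_bundle1.
  - by rewrite eT card_bundle1.
  - rewrite disjoint_subset; apply/subsetP => -[x t].
    by rewrite !inE /= => /(disjointFr dIJ) ->.
  - by move=> b; rewrite eT !card_bundle1_color; apply: tr.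
  - move=> b; apply/induced_treeE; rewrite switch_const color_class_bundle.
    exact: tree_const.
  - move=> b; rewrite switch_const color_class_bundle; apply/splitsE.
    have /splitsE [A [B [[-> sAB tA tB] [[x xA xI] [y yB yJ]]]]] := sJ b.
    exists (bundle [set: T] (fun=> A)), (bundle [set: T] (fun=> B)).
    split; split.
    + exact: bundle1U.
    + by apply: separated_bundle => // t u _ _; rewrite (negbTE (noadj t u)).
    + exact: tree_const.
    + exact: tree_const.
    + by exists (x, r0); rewrite in_bundle inE.
    + by exists (y, r0); rewrite in_bundle inE.
have [r [w [_ pr]]] := set_tree_pendant tT (in_setT r0) nT.
have nTr : [set: T] <> [set r].
  by move=> eT; case: nT; have := in_setT r0; rewrite eT => /set1P ->.
have [s [w' [nsr ps]]] := set_tree_pendant tT (in_setT r) nTr.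
have [p0 p0P] := set_tree_bipartite tT.
(* Normalized to be false at [r], so that the copy over [r] is colored by [C] itself. *)
pose p t := p0 t (+) p0 r.
have pP t u : adj t u -> p t = ~~ p u.
  move=> tu; have := p0P t u (in_setT _) (in_setT _) tu.
  by rewrite /p; case: (p0 t) (p0 u) (p0 r) => [] [] [].
have pr0 : p r = false by rewrite /p addbb.
pose F t := if p t then neg_coloring (switch C I) else C.
pose X b t := color_class (F t) b.
have FI t x : x \in I -> F t x = C x.
  by rewrite /F; case: (p t) => // xI; rewrite !ffunE xI negbK.
have tX b t : set_tree (X b t).
  by rewrite /X /F; case: ifP => _; rewrite ?color_class_neg.
(* Colorings of adjacent copies agree exactly on [I], which has one vertex of each color; hence the
   fibers of one color meet in one vertex. *)
have XX b t u : adj t u -> X b t :&: X b u = I :&: color_class C b.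
  move=> /pP ptu; apply/setP => x; rewrite !inE /F ptu.
  case: (p u); rewrite /= !ffunE; case: (x \in I); case: (C x); case: b => //.
have eX b t u : adj t u -> #|X b t :&: X b u| = 1.
  by move=> tu; rewrite (XX b t u tu); case: (tr b).
have exI b : exists x, I :&: color_class C b = [set x].
  by apply/cards1P/eqP; case: (tr b).
have exJ b : exists x, J :&: color_class C b = [set x].
  by apply/cards1P/eqP; case: (tr b).
exists (bundle_coloring F); split.
  move=> b; apply/induced_treeE; rewrite color_class_bundle.
  by apply: (set_tree_bundle (X := X b)) => // t u _ _; apply: eX.
exists (bundle [set r] (fun=> J)), (bundle [set s] (fun=> I)); split; split.
- by rewrite card_bundle1.
- by rewrite card_bundle1.
- rewrite disjoint_subset; apply/subsetP => -[x t].
  rewrite !inE /= => /andP [/eqP -> _].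
  by rewrite eq_sym; move/eqP/negbTE: nsr => ->.
(* The value of [p s] is unknown, but [F s] agrees with [C] on [I] in either case. *)
- move=> b; rewrite !card_bundle1_color {1}/F pr0; split; first by case: (tr b).
  have -> : I :&: color_class (F s) b = I :&: color_class C b.
    by apply/setP => x; rewrite !inE; case: (boolP (x \in I)) => // /FI ->.
  by case: (tr b).
- move=> b; apply/induced_treeE; rewrite switch_bundle color_class_bundle.
  rewrite -(setD1K (in_setT r)) bundleU.
  have /splitsE [A [B [[eAB sAB tA tB] [[i iA iI] [j jB jJ]]]]] := sJ b.
  have -> : bundle [set r] (fun t => color_class
      (if t == r then switch (F t) J else F t) b) =
      bundle [set r] (fun=> A) :|: bundle [set r] (fun=> B).
    rewrite -bundle1U -eAB; apply: eq_bundle => t /set1P ->.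
    by rewrite eqxx /F pr0.
  have -> : bundle ([set: T] :\ r) (fun t => color_class
      (if t == r then switch (F t) J else F t) b) = bundle ([set: T] :\ r) (X b).
    by apply: eq_bundle => t /setD1P [/negbTE ->].
  have brT := pendant_bridge pr; have [_ _ rw _] := pr.
  have Fw : F w = neg_coloring (switch C I).
    by rewrite /F -[p w]negbK -(pP r w rw) pr0.
  have iX : i \in color_class (switch C J) b by rewrite eAB inE iA.
  have jX : j \in color_class (switch C J) b by rewrite eAB inE jB orbT.
  have iJ : i \notin J by rewrite (disjointFr dIJ iI).
  have jI : j \notin I by rewrite (disjointFl dIJ jJ).
  have Ci : C i = b by move: iX; rewrite !inE ffunE (negbTE iJ) => /eqP.
  have Cj : C j = ~~ b by move: jX; rewrite !inE ffunE jJ => /eqP <-; rewrite negbK.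
  have iw : i \in X b w by rewrite inE Fw !ffunE iI negbK Ci.
  have jw : j \in X b w by rewrite inE Fw !ffunE (negbTE jI) Cj negbK.
  (* Relative to [C], the coloring over [w] is flipped off [I], and the switched one over [r] is
     flipped on [J]. They agree just on [I] and [J], where color [b] occurs at [i] and at [j]
     only. *)
  have uX x : x \in color_class (switch C J) b -> x \in X b w -> x = i \/ x = j.
    rewrite !inE Fw !ffunE; case: (boolP (x \in I)) => [xI|nxI].
      rewrite negbK => _ Cx; left; have [i' ei'] := exI b.
      have /set1P -> : x \in [set i'] by rewrite -ei' !inE xI Cx.
      by apply/esym/set1P; rewrite -ei' !inE iI Ci eqxx.
    case: (boolP (x \in J)) => [xJ|nxJ] Cx; last by rewrite (eqP Cx); case: (b).
    move=> _; right; have [j' ej'] := exJ (~~ b).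
    have /set1P -> : x \in [set j'] by rewrite -ej' !inE xJ -(eqP Cx) negbK eqxx.
    by apply/esym/set1P; rewrite -ej' !inE jJ Cj eqxx.
  have brA : bridge (bundle [set r] (fun=> A)) (bundle ([set: T] :\ r) (X b))
      (i, r) (i, w).
    apply: bridge_bundle => // y yA yw; case: (uX y _ yw) => // [|ey].
      by rewrite eAB inE yA.
    by move: yA; rewrite ey (disjointFl sAB.1 jB).
  have brB : bridge (bundle [set r] (fun=> B)) (bundle ([set: T] :\ r) (X b))
      (j, r) (j, w).
    apply: bridge_bundle => // y yB yw; case: (uX y _ yw) => // [|ey].
      by rewrite eAB inE yB orbT.
    by move: yB; rewrite ey (disjointFr sAB.1 iA).
  have sBA : separated (bundle [set r] (fun=> B)) (bundle [set r] (fun=> A)).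
    apply: separated_bundle => [t _ _|t u /set1P -> /set1P ->].
      exact: separated_sym.
    by rewrite adj_irr.
  have tK : set_tree (bundle ([set: T] :\ r) (X b)).
    apply: set_tree_bundle => //; first exact: set_tree_del_pendant pr.
    by move=> t u _ _; apply: eX.
  (* The parts are regrouped: [A] is glued to the copies off [r], then [B] to the result, with no
     edge between [A] and [B] to add a second connection. *)
  rewrite -setUA setUC -setUA.
  apply: bridge_set_tree (bridge_separated brB sBA) _ _.
    exact: set_tree_bundle1.
  by rewrite setUC; apply: bridge_set_tree brA _ tK; apply: set_tree_bundle1.
- move=> b; rewrite switch_bundle color_class_bundle; apply/splitsE.
  exists (bundle ([set: T] :\ s) (X b)),
    (bundle [set s] (fun=> color_class (switch (F s) I) b)); split; split.
  + rewrite -{1}(setD1K (in_setT s)) bundleU setUC; congr (_ :|: _).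
      by apply: eq_bundle => t /setD1P [/negbTE ->].
    by apply: eq_bundle => t /set1P ->; rewrite eqxx.
  (* After the switch, the coloring over [s] is the exact opposite of the one over any neighbour of
     [s], so fibers of the same color are disjoint. *)
  + apply: separated_bundle => [t /setD1P [/negP nts _] /set1P ets|].
      by case: nts; rewrite ets eqxx.
    move=> t u _ /set1P -> ts; rewrite disjoint_subset; apply/subsetP => x.
    rewrite !inE /F (pP _ _ ts); case: (p s); rewrite /= !ffunE;
    by case: (x \in I); case: (C x); case: b.
  + apply: set_tree_bundle => //; first exact: set_tree_del_pendant ps.
    by move=> t u _ _; apply: eX.
  (* The switched coloring over [s] is [switch C I] or the complement of [C], according to [p s]. *)
  + apply: set_tree_bundle1; rewrite /F; case: (p s) => //.
    have -> : switch (neg_coloring (switch C I)) I = neg_coloring C.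
      by apply/ffunP => x; rewrite !ffunE; case: (x \in I); rewrite ?negbK.
    by rewrite color_class_neg.
  + have [j ej] := exJ b.
    have /setIP [jJ jC] : j \in J :&: color_class C b by rewrite ej set11.
    exists (j, r); rewrite in_bundle !inE ?eqxx ?jJ //.
    by rewrite eq_sym; move/eqP: nsr => -> /=; rewrite /F pr0; rewrite inE in jC.
  (* The vertex of [I] with color [~~ b] is the one that the switch brings to color [b]. *)
  + have [i ei] := exI (~~ b).
    have /setIP [iI iC] : i \in I :&: color_class C (~~ b) by rewrite ei set11.
    exists (i, s); rewrite in_bundle !inE eqxx ?iI //= ffunE iI FI //.
    by move: iC; rewrite inE => /eqP ->; rewrite negbK.
Qed.
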